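(* For every integer $n\ge1$ and $m\ge0$, \[ \mathcal{C}_{n,m}^{(k)}(a,q,L)=\sum_{j=1}^{n}\sum_{i=1}^{n}q^{n-j}\frac{(-1)^{i-j}}{i!}s(n,i)s(i,j)\mathcal{B}_{j,m}^{(k)}(a,q,L), \] \[ \widehat{\mathcal{C}}_{n,m}^{(k)}(a,q,L)=\sum_{j=1}^{n}\sum_{i=1}^{n}(-1)^jq^{n-j}\frac{1}{i!}s(n,i)s(i,j)\mathcal{B}_{j,m}^{(k)}(a,q,L). \]
   Context: Let $k\ge1$ be an integer, $a,q,l_1,\dots,l_k$ nonzero reals, $l=\prod l_i$, $L=(l_1,\dots,l_k)$; denominators $a+j$ ($j\ge0$ integer) assumed nonzero and $l^{a+i}$ means $l^al^i$. Let $s(n,i)$ be the signed Stirling numbers of the first kind ($\frac{1}{i!}(\ln(1+x))^i=\sum_{n\ge i}s(n,i)\frac{x^n}{n!}$) and $\left\{ {n \atop i} \right\}$ the Stirling numbers of the second kind. Define \[ \mathcal{C}_{n,m}^{(k)}(a,q,L)=\frac{(a+m)^k}{a^k}\sum_{i=0}^{n}s(n,i)\frac{q^{n-i}l^{a+i}}{(a+i+m)^k},\quad \widehat{\mathcal{C}}_{n,m}^{(k)}(a,q,L)=\frac{(a+m)^k}{a^k}\sum_{i=0}^{n}s(n,i)\frac{(-1)^iq^{n-i}l^{a+i}}{(a+i+m)^k}, \] \[ \mathcal{B}_{n,m}^{(k)}(a,q,L)=\frac{(a+m)^k}{a^k}\sum_{i=0}^{n}\frac{i!(-q)^{n-i}l^{i+a}}{(a+m+i)^k}\left\{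 {n \atop i} \right\}. \] *)

(* Defs.v *)
From HB Require Import structures.
From mathcomp Require Import all_boot all_order all_algebra.
From mathcomp Require Import complex ring.
From mathcomp Require Import reals sequences exp trigo.

Set Implicit Arguments.
Unset Strict Implicit.
Unset Printing Implicit Defensive.

Import Order.TTheory GRing.Theory Num.Theory.
Local Open Scope ring_scope.
Local Open Scope complex_scope.

(* The power series of ln(1 + x) modulo x^(N+1). *)
Definition log1p_poly (F : numFieldType) (N : nat) : {poly F} :=
  \sum_(1 <= r < N.+1) ((-1) ^+ r.-1 / r%:R) *: 'X^r.

(* Signed Stirling number of the first kind: n! times the coefficient of x^n
   in (ln(1 + x))^i / i!.  Terms of degree > n do not affect this coefficient,
   so the series may be truncated; see [stirling1_gf]. *)
Definition stirling1 (F : numFieldType) (n i : nat) : F :=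
  n`!%:R * ((i`!%:R)^-1 *: log1p_poly F n ^+ i)`_n.

Definition stirling2 (n i : nat) : nat :=
  #|[set P : {set {set 'I_n}} | partition P [set: 'I_n] & #|P| == i]|.

(* The generating function identity
   (ln(1 + x))^i / i! = \sum_n s(n, i) x^n / n!  modulo x^(N+1). *)
Lemma stirling1_gf (F : numFieldType) (N n i : nat) : (n <= N)%N ->
  ((i`!%:R)^-1 *: log1p_poly F N ^+ i)`_n = stirling1 F n i / n`!%:R.
Proof.
move=> nN.
have nz : n`!%:R != 0 :> F by rewrite pnatr_eq0 -lt0n fact_gt0.
rewrite /stirling1 mulrAC mulfV // mul1r !coefZ; congr (_ * _).
have logE j : (j <= n)%N -> (log1p_poly F N)`_j = (log1p_poly F n)`_j.
  move=> jn; rewrite /log1p_poly (big_cat_nat (n := n.+1)) //= coefD.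
  rewrite [X in _ + X]coef_sum [X in _ + X]big_nat_cond [X in _ + X]big1 ?addr0 //.
  move=> r /andP[/andP[nr _] _].
  by rewrite coefZ coefXn (ltn_eqF (leq_ltn_trans jn nr)) mulr0.
suff: forall j, (j <= n)%N -> (log1p_poly F N ^+ i)`_j = (log1p_poly F n ^+ i)`_j by apply.
elim: i => [|i IH] j jn; first by rewrite !expr0.
rewrite !exprS !coefM; apply: eq_bigr => h _.
by rewrite logE ?IH // (leq_trans _ jn) ?leq_subr // -ltnS ltn_ord.
Qed.

(* Real powers of a nonzero real number that may be negative: the value
   exp(x * log c) on the branch log c = ln |c| + i * (arg c + 2 pi b), where
   arg c = 0 if c > 0 and arg c = pi if c < 0.  For b = 0 this is the principal
   value, which is the usual real power when c > 0. *)
Definition log_arg (R : realType) (b : int) (c : R) : R :=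
  (if c < 0 then pi else 0) + (pi *+ 2) *~ b.

Definition rcpow (R : realType) (b : int) (c x : R) : R[i] :=
  (expR (x * ln `|c|))%:C
  * (cos (x * log_arg b c) +i* sin (x * log_arg b c)).

Lemma rcpow_pos (R : realType) (c x : R) : 0 < c ->
  rcpow 0 c x = (c `^ x)%:C.
Proof.
move=> c0; rewrite /rcpow /log_arg ltNge (ltW c0) /= mulr0z addr0 mulr0 cos0 sin0.
by rewrite mulr1 /powR gt_eqF // gtr0_norm.
Qed.

Lemma log_argE (R : realType) (b : int) (c : R) : c != 0 ->
  (`|c| * cos (log_arg b c) = c) /\ (sin (log_arg b c) = 0).
Proof.
move=> c0.
have pE (x : R) : cos (x + (pi *+ 2) *~ b) = cos x /\ sin (x + (pi *+ 2) *~ b) = sin x.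
  case: b => n; first by rewrite -pmulrn (periodicn (@cosD2pi R)) (periodicn (@sinD2pi R)).
  rewrite NegzE mulrNz -pmulrn.
  set T := pi *+ 2 *+ n.+1; rewrite -{2 4}(subrK T x).
  by rewrite (periodicn (@cosD2pi R)) (periodicn (@sinD2pi R)).
rewrite /log_arg; have [-> ->] := pE (if c < 0 then pi else 0).
case: ltP => cs; first by rewrite cospi sinpi ltr0_norm // mulrNN mulr1.
by rewrite cos0 sin0 ger0_norm // mulr1.
Qed.

Lemma rcpowD_nat (R : realType) (b : int) (c x : R) (n : nat) : c != 0 ->
  rcpow b c (x + n%:R) = rcpow b c x * c%:C ^+ n.
Proof.
move=> c0; elim: n x => [|n IH] x; first by rewrite addr0 mulr1.
rewrite -natr1 addrA addrAC IH exprS mulrA; congr (_ * _).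
have [] := log_argE b c0; rewrite /rcpow; move: (log_arg b c) => t cosE sinE.
rewrite !mulrDl !mul1r expRD lnK ?posrE ?normr_gt0 // cosD sinD sinE.
move: (cos _) (sin _) (expR _) => u v w; rewrite -{2}cosE.
by apply/eqP; rewrite eq_complex /=; apply/andP; split; apply/eqP; ring.
Qed.

(* In the three families below, L = (l_1, ..., l_k), l is the product of the
   l_i, and l^(a+i) is l^a * l^i with l^a taken on the branch b. *)
Definition polyCauchy1 (R : realType) (b : int) (k n m : nat) (a q : R)
    (L : 'I_k -> R) : R[i] :=
  let l := \prod_(h < k) L h in
  ((a + m%:R) ^+ k / a ^+ k)%:C *
  \sum_(0 <= i < n.+1)
    (stirling1 R n i * q ^+ (n - i) / (a + i%:R + m%:R) ^+ k)%:C
    * (rcpow b l a * l%:C ^+ i).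

Definition polyCauchy2 (R : realType) (b : int) (k n m : nat) (a q : R)
    (L : 'I_k -> R) : R[i] :=
  let l := \prod_(h < k) L h in
  ((a + m%:R) ^+ k / a ^+ k)%:C *
  \sum_(0 <= i < n.+1)
    (stirling1 R n i * ((-1) ^+ i * q ^+ (n - i)) / (a + i%:R + m%:R) ^+ k)%:C
    * (rcpow b l a * l%:C ^+ i).

Definition polyBernoulli (R : realType) (b : int) (k n m : nat) (a q : R)
    (L : 'I_k -> R) : R[i] :=
  let l := \prod_(h < k) L h in
  ((a + m%:R) ^+ k / a ^+ k)%:C *
  \sum_(0 <= i < n.+1)
    (i`!%:R * (- q) ^+ (n - i) / (a + m%:R + i%:R) ^+ k * (stirling2 n i)%:R)%:C
    * (rcpow b l a * l%:C ^+ i).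

(* Main.v *)
Require Import Defs.
From HB Require Import structures.
From mathcomp Require Import all_boot all_order all_algebra.
From mathcomp Require Import complex ring.
From mathcomp Require Import reals.
Import Order.TTheory GRing.Theory Num.Theory.
Local Open Scope ring_scope.
Local Open Scope complex_scope.

(** Expanding the poly-Bernoulli numbers on the right-hand sides and exchanging
    the sums, both identities reduce to the orthogonality relation
    [\sum_j s(i, j) S(j, p) = (i == p)].  It follows by induction on [i] from the
    triangular recurrences: the one for [s] comes from the differential equation
    [(1 + x) (log (1 + x))' = 1], the one for [S] from adjoining a point to a
    partition either as a new singleton or inside an existing block. *)

(** * First kind: boundary values and triangular recurrence *)

Lemma stirling1_0S (F : numFieldType) i : stirling1 F 0 i.+1 = 0.
Proof.
by rewrite /stirling1 /log1p_poly big_geq // expr0n scaler0 coef0 mulr0.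
Qed.

Lemma stirling1_S0 (F : numFieldType) n : stirling1 F n.+1 0 = 0.
Proof. by rewrite /stirling1 expr0 coefZ coef1 !mulr0. Qed.

Lemma stirling1_00 (F : numFieldType) : stirling1 F 0 0 = 1.
Proof. by rewrite /stirling1 expr0 coefZ coef1 fact0 invr1 !mulr1. Qed.

(** The derivative is the geometric sum of the [(- 'X) ^+ r] for [r < N], so multiplying by [1 + 'X]
    telescopes. The truncation error has degree [N]. *)
Lemma deriv_log1p_poly (F : numFieldType) N :
  (1 + 'X) * (log1p_poly F N)^`() = 1 - (- 'X) ^+ N.
Proof.
elim: N => [|N IH].
  by rewrite /log1p_poly big_geq // derivC mulr0 expr0 subrr.
have -> : log1p_poly F N.+1 =
    log1p_poly F N + ((-1) ^+ N / N.+1%:R) *: 'X^(N.+1).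
  by rewrite /log1p_poly big_nat_recr.
rewrite derivD mulrDr IH derivZ derivXn /= -scaler_nat scalerA mulfVK ?pnatr_eq0 //.
have -> : (- 'X : {poly F}) ^+ N.+1 = - 'X * (- 'X) ^+ N by rewrite exprS.
have -> : (-1) ^+ N *: 'X^N = (- 'X : {poly F}) ^+ N.
  by rewrite (exprNn 'X) -mul_polyC polyC_exp polyCN.
ring.
Qed.

(** Compare the coefficients of [x^n] in [(1 + x) (P^(i+1))' = (i+1) P^i (1 + x) P'], where
    [(1 + x) P'] is 1 up to degree [n]. *)
Lemma stirling1_SS (F : numFieldType) n i :
  stirling1 F n.+1 i.+1 = stirling1 F n i - n%:R * stirling1 F n i.+1.
Proof.
have nzf j : j`!%:R != 0 :> F by rewrite pnatr_eq0 -lt0n fact_gt0.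
(* Differentiating calls for the coefficient of degree [n.+1], hence this truncation order; the
   error in [(1 + x) P'] then starts in degree [n.+1]. *)
set P := log1p_poly F n.+1.
have coefP m j : (m <= n.+1)%N ->
    (P ^+ j)`_m = j`!%:R * (stirling1 F m j / m`!%:R).
  by move=> mn; rewrite -(@stirling1_gf F n.+1) // coefZ mulVKf.
have coef_XD (Q : {poly F}) : ((1 + 'X) * Q^`())`_n = Q`_n.+1 *+ n.+1 + Q`_n *+ n.
  rewrite mulrDl mul1r coefD coefXM coef_deriv; congr (_ + _).
  by case: n {P coefP} => [|n]; rewrite ?mulr0n //= coef_deriv.
have := coef_XD (P ^+ i.+1).
rewrite deriv_exp mulrnAr mulrA deriv_log1p_poly.
have coef_trunc (Q : {poly F}) : ((1 - (- 'X) ^+ n.+1) * Q)`_n = Q`_n.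
  by rewrite mulrC mulrBr mulr1 exprNn mulrA coefB coefMXn ltnSn subr0.
rewrite coefMn coef_trunc -!(mulr_natl (nth _ _ _)) !coefP // !factS !natrM => E.
have nn : n.+1%:R != 0 :> F by rewrite pnatr_eq0.
have ii : i.+1%:R != 0 :> F by rewrite pnatr_eq0.
have := nzf n; have := nzf i; move: E nn ii.
move: (n`!%:R) (i`!%:R) (stirling1 F n.+1 i.+1) (stirling1 F n i) => u v w z.
move: (stirling1 F n i.+1) (n.+1%:R) (i.+1%:R) (n%:R) => y n1 i1 n0 E.
move=> hn1 hi1 hv hu.
(* The factor is [(i+1)! / n!], by which the coefficient identity [E] differs from the
   recurrence. *)
have c : i1 * v / u != 0 by rewrite !mulf_neq0 ?invr_eq0.
apply: (mulfI c); rewrite mulrBr.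
have -> : i1 * v / u * z = i1 * (v * (z / u)) by ring.
rewrite E.
field.
by rewrite hu hn1.
Qed.

(** * Second kind: counting set partitions by adjoining a point *)

Section SetPartitions.
Variable T : finType.
Implicit Types (A B : {set T}) (P Q : {set {set T}}) (x : T) (i : nat).
Local Open Scope nat_scope.

Definition set_partitions A i : {set {set {set T}}} :=
  [set P | partition P A & #|P| == i].

Lemma set_partitionsP A i P :
  reflect (partition P A /\ #|P| = i) (P \in set_partitions A i).
Proof. by rewrite inE; apply: (iffP andP) => -[? /eqP]. Qed.

Lemma partition_notin P A B x :
  partition P A -> x \notin A -> x \in B -> B \notin P.
Proof.
by move=> PA nAx Bx; apply: contra nAx => /(partitionS PA)/subsetP; apply.
Qed.

(** Adjoining the block [[set x]] is a bijection from the partitions of [A]; deleting that block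
    inverts it. *)
Lemma card_set_partitions_singleton A x i : x \notin A ->
  #|set_partitions (x |: A) i.+1 :&: [set P : {set {set T}} | [set x] \in P]|
    = #|set_partitions A i|.
Proof.
move=> nAx.
have fresh Q : partition Q A -> [set x] \notin Q.
  by move=> QA; apply: partition_notin QA nAx _; rewrite set11.
have -> : set_partitions (x |: A) i.+1 :&: [set P : {set {set T}} | [set x] \in P]
          = [set [set x] |: Q | Q in set_partitions A i].
  apply/setP => P; apply/setIP/imsetP => [[]|].
    move=> /set_partitionsP[PxA cP]; rewrite inE => Px.
    exists (P :\ [set x]); last by rewrite setD1K.
    apply/set_partitionsP; split; last by move: cP; rewrite (cardsD1 [set x]) Px => -[].
    by rewrite -(setU1K nAx); apply: partitionD1.
  move=> [Q /set_partitionsP[QA cQ] ->]; split; last by rewrite !inE eqxx.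
  apply/set_partitionsP; split; last by rewrite cardsU1 fresh // cQ.
  apply: partitionU1 => //; last by rewrite disjoints1.
  by apply/set0Pn; exists x; rewrite set11.
apply: card_in_imset => Q1 Q2 /set_partitionsP[/fresh f1 _]
  /set_partitionsP[/fresh f2 _] E.
by rewrite -(setU1K f1) E setU1K.
Qed.

(** Such a partition amounts to a pair of a partition [Q] of [A] and a block of [Q], the one that
    receives [x]; each [Q] offers [i] blocks. The map [add] inserts [x], and [del] recovers the pair
    by removing [x] from its block. *)
Lemma card_set_partitions_nonsingleton A x i : x \notin A ->
  #|set_partitions (x |: A) i :\: [set P : {set {set T}} | [set x] \in P]|
    = i * #|set_partitions A i|.
Proof.
move=> nAx.
pose pointed := [set u : {set {set T}} * {set T}
                  | (u.1 \in set_partitions A i) && (u.2 \in u.1)].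
pose add (u : {set {set T}} * {set T}) := (x |: u.2) |: (u.1 :\ u.2).
pose del P := ((pblock P x :\ x) |: (P :\ pblock P x), pblock P x :\ x).
have nBx Q B : partition Q A -> B \in Q -> x \notin B.
  by move=> QA QB; apply: contraTN QB; apply: partition_notin QA nAx.
have addP Q B : partition Q A -> B \in Q ->
    partition (add (Q, B)) (x |: A) /\ (x |: B) \notin Q :\ B.
  move=> QA QB; rewrite /add /=; split; last first.
    apply/negP => /setD1P[_]; apply/negP.
    by apply: (partition_notin _ A _ x) => //; rewrite setU11.
  have -> : x |: A = (x |: B) :|: (A :\: B).
    rewrite -setUA; congr (_ :|: _); rewrite setDE setUIr setUCr setIT.
    by apply/esym/setUidPr/(partitionS QA).
  apply: partitionU1; first exact: partitionD1.
    by apply/set0Pn; exists x; rewrite setU11.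
  rewrite -setI_eq0; apply/eqP/setP => y; rewrite !inE.
  by have [->|] := eqVneq y x; rewrite ?(negPf nAx) ?andbF //=; case: (y \in B).
have addK : {in pointed, cancel add del}.
  move=> [Q B]; rewrite inE /= => /andP[/set_partitionsP[QA _] QB].
  have [PxA fr] := addP _ _ QA QB.
  rewrite /del (def_pblock (B := x |: B) (partition_trivIset PxA)) ?setU11 //.
  by rewrite /add /= setU1K ?(nBx Q) // setU1K // setD1K.
have -> : set_partitions (x |: A) i :\: [set P : {set {set T}} | [set x] \in P]
          = add @: pointed.
  apply/setP => P; apply/setDP/imsetP => [[]|].
    move=> /set_partitionsP[PxA cP]; rewrite inE => nPx.
    have Bx : x \in pblock P x by rewrite mem_pblock (cover_partition PxA) setU11.
    have PB : pblock P x \in P by apply: pblock_mem; rewrite -mem_pblock.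
    set C := pblock P x in Bx PB.
    (* Otherwise [C :\ x] would be a block other than [C], hence disjoint from [C]; being contained
       in [C], it would be empty, which no block is. *)
    have nP : C :\ x \notin P :\ C.
      apply/negP => /setD1P[ne PC].
      have /trivIsetP/(_ _ _ PC PB ne) := partition_trivIset PxA.
      rewrite -setI_eq0 (setIidPl (subsetDl _ _)) => /eqP C0.
      by move: (partition0 PxA); rewrite -C0 PC.
    exists (del P); rewrite /add /del /= -/C; last by rewrite setU1K // !setD1K.
    rewrite inE /= setU11 andbT; apply/set_partitionsP; split; last first.
      by rewrite cardsU1 nP -cP [in RHS](cardsD1 C) PB.
    have -> : A = (C :\ x) :|: ((x |: A) :\: C).
      apply/setP => y; rewrite !inE.
      have [->|yx] /= := eqVneq y x; first by rewrite Bx (negPf nAx).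
      case yC: (y \in C) => //=.
      by move/subsetP: (partitionS PxA PB) => /(_ _ yC); rewrite !inE (negPf yx).
    apply: partitionU1; first exact: partitionD1.
      apply: contra nPx => /eqP C0; suff <- : C = [set x] by [].
      by rewrite -(setD1K Bx) C0 setU0.
    rewrite -setI_eq0; apply/eqP/setP => y; rewrite !inE.
    by case: (y \in C); rewrite ?andbF.
  move=> [[Q B]]; rewrite inE /= => /andP[/set_partitionsP[QA cQ] QB] ->.
  have [PxA fr] := addP _ _ QA QB.
  split; first by apply/set_partitionsP; split=> //;
    rewrite /add /= cardsU1 fr -cQ [in RHS](cardsD1 B) QB.
  rewrite !inE negb_or negb_and; apply/andP; split; last first.
    by apply/orP; right; apply: partition_notin QA nAx _; rewrite set11.
  (* If [x |: B] were [[set x]], the block [B] would be empty. *)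
  apply: contra (partition_neq0 QA QB) => /eqP E.
  by rewrite -(setU1K (nBx _ _ QA QB)) -E setDv.
rewrite (card_in_imset (can_in_inj addK)) -sum1_card.
rewrite (eq_bigl (fun u => (u.1 \in set_partitions A i) && (u.2 \in u.1))); last first.
  by move=> u; rewrite inE.
rewrite -(pair_big_dep (fun Q => Q \in set_partitions A i)
  (fun Q B => B \in Q) (fun _ _ => 1)) /=.
rewrite mulnC -sum_nat_const; apply: eq_bigr => Q /set_partitionsP[_ cQ].
by rewrite sum1_card.
Qed.

Lemma card_set_partitionsU1 A x i : x \notin A ->
  #|set_partitions (x |: A) i.+1|
    = #|set_partitions A i| + i.+1 * #|set_partitions A i.+1|.
Proof.
move=> nAx; rewrite -(cardsID [set P : {set {set T}} | [set x] \in P]).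
by rewrite card_set_partitions_singleton // card_set_partitions_nonsingleton.
Qed.

Lemma card_set_partitions0 A : #|set_partitions A 0| = (A == set0).
Proof.
have [->|/set0Pn[x Ax]] := eqVneq A set0.
  rewrite -[RHS](cards1 (@set0 {set T})); congr #|pred_of_set _|.
  apply/setP => P; rewrite !inE partition_set0.
  by have [->|] := eqVneq P set0; rewrite ?cards0.
apply/eqP; rewrite cards_eq0; apply/eqP/setP => P; rewrite !inE; apply/negP.
case/andP => PA; rewrite cards_eq0 => /eqP P0.
by move: Ax; rewrite -(cover_partition PA) P0 /cover big_set0 inE.
Qed.

Lemma card_set_partitions_set0 i : #|set_partitions set0 i.+1| = 0.
Proof.
apply/eqP; rewrite cards_eq0; apply/eqP/setP => P; rewrite !inE partition_set0.
by have [->|] := eqVneq P set0; rewrite ?cards0.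
Qed.
End SetPartitions.

Fixpoint stirling2_rec n i : nat :=
  match n, i with
  | 0, 0 => 1
  | n'.+1, i'.+1 => (stirling2_rec n' i' + i * stirling2_rec n' i)%N
  | _, _ => 0
  end.

(** Taking an arbitrary set [A] instead of all of ['I_n] lets the induction remove a point without
    changing the ambient type. *)
Lemma card_set_partitions (T : finType) (A : {set T}) i :
  #|set_partitions T A i| = stirling2_rec #|A| i.
Proof.
move cA: #|A| => n; elim: n A cA i => [|n IH] A cA i.
  move/eqP: cA; rewrite cards_eq0 => /eqP ->.
  by case: i => [|i]; rewrite ?card_set_partitions0 ?eqxx ?card_set_partitions_set0.
have /card_gt0P[x Ax] : (0 < #|A|)%N by rewrite cA.
have cA' : #|A :\ x| = n by move: cA; rewrite (cardsD1 x) Ax => -[].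
case: i => [|i].
  by rewrite card_set_partitions0 -cards_eq0 cA.
by rewrite -{1}(setD1K Ax) card_set_partitionsU1 ?setD11 // !IH.
Qed.

Lemma stirling2E n i : stirling2 n i = stirling2_rec n i.
Proof. by rewrite -[n in RHS]card_ord -cardsT -card_set_partitions. Qed.

Lemma stirling2_rec_small n i : (n < i)%N -> stirling2_rec n i = 0%N.
Proof.
elim: n i => [|n IH] [|i] //= ni.
by rewrite !IH ?muln0 // ltnW.
Qed.

(** * Orthogonality of the two kinds *)

Lemma stirling_orthogonality (F : numFieldType) N i p : (i < N)%N ->
  \sum_(0 <= j < N) stirling1 F i j * (stirling2 j p)%:R = (i == p)%:R.
Proof.
under eq_bigr do rewrite stirling2E.
elim: i N p => [|i IH] [//|N] p iN.
  rewrite big_nat_recl // big1 ?addr0 => [|j _]; last by rewrite stirling1_0S mul0r.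
  by rewrite stirling1_00 mul1r; case: p.
(* The shifted sum lacks only the term of index 0, which contains [stirling1 F i 0]: it vanishes for
   positive [i], and for [i = 0] the prefactor kills it. *)
have shift : i%:R * (\sum_(0 <= j < N) stirling1 F i j.+1 * (stirling2_rec j.+1 p)%:R)
    = i%:R * (i == p)%:R :> F.
  rewrite -(IH N.+1) 1?ltnW // big_nat_recl // mulrDr.
  by case: i {IH iN} => [|i]; rewrite ?stirling1_S0 !mul0r ?mulr0 add0r.
rewrite big_nat_recl // stirling1_S0 mul0r add0r.
under eq_bigr do rewrite stirling1_SS mulrBl -(mulrA i%:R).
rewrite sumrB -mulr_sumr shift.
case: p {shift} => [|p].
  rewrite big1 => [|j _]; last by rewrite mulr0.
  by case: i {IH iN} => [|i]; rewrite ?mul0r ?mulr0 subrr.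
under eq_bigr do rewrite natrD natrM mulrDr mulrCA.
rewrite big_split /= -mulr_sumr !IH // eqSS.
(* For [i = p.+1] the contribution [p.+1] of the second-kind recurrence cancels the [i] of the
   first-kind one. *)
by have [->|] := eqVneq i p.+1; rewrite ?mulr0 ?addrK ?subr0 ?addr0.
Qed.

(** * From orthogonality to the two identities *)

Lemma stirling_sum_collapse (F : numFieldType) (w : nat -> F) n p :
  (0 < n)%N -> (p <= n)%N ->
  \sum_(1 <= j < n.+1) \sum_(1 <= i < n.+1)
    w i * stirling1 F n i * (stirling1 F i j * (stirling2 j p)%:R)
  = w p * stirling1 F n p.
Proof.
move=> n0 pn; rewrite exchange_big_nat /=.
under eq_big_nat => i /andP[i0 iN].
  rewrite -mulr_sumr.
  (* Since [i] is positive, [stirling1 F i 0 = 0], so the sum may start at 0 as orthogonality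
     requires. *)
  have <- : \sum_(0 <= j < n.+1) stirling1 F i j * (stirling2 j p)%:R
      = \sum_(1 <= j < n.+1) stirling1 F i j * (stirling2 j p)%:R.
    by rewrite big_ltn //; case: i i0 {iN} => // i _; rewrite stirling1_S0 mul0r add0r.
  rewrite stirling_orthogonality //.
  over.
(* For [p = 0] no [i] in the range matches, and the right side is 0 because [n] is positive; for
   positive [p] exactly the term [i = p] survives. *)
have [->|p0] := posnP p.
  case: n n0 {pn} => // n _; rewrite stirling1_S0 mulr0 big_nat big1 // => i /andP[].
  by case: i => // i _ _; rewrite mulr0.
rewrite (bigD1_seq p) ?mem_index_iota ?iota_uniq ?p0 ?ltnS //= eqxx mulr1.
by rewrite big1 ?addr0 // => i /negPf ->; rewrite mulr0.
Qed.

(** Reduces both identities to real ones by collecting the coefficient of each [l^(a+p)]; [c] holds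
    the weights of the double sum and [d] the resulting coefficients. *)
Lemma sum_polyBernoulli (R : realType) (b : int) (k n m : nat) (a q : R)
    (L : 'I_k -> R) (c : nat -> nat -> R) (d : nat -> R) :
  let l := \prod_(h < k) L h in
  (forall p, (p <= n)%N -> \sum_(1 <= j < n.+1) \sum_(1 <= i < n.+1)
     c i j * (p`!%:R * (- q) ^+ (j - p) * (stirling2 j p)%:R) = d p) ->
  \sum_(1 <= j < n.+1) \sum_(1 <= i < n.+1)
    (c i j)%:C * polyBernoulli b j m a q L
  = ((a + m%:R) ^+ k / a ^+ k)%:C *
    \sum_(0 <= p < n.+1)
      (d p / (a + m%:R + p%:R) ^+ k)%:C * (rcpow b l a * l%:C ^+ p).
Proof.
move=> l dE.
pose t p := ((a + m%:R + p%:R) ^+ k)^-1%:C * (rcpow b l a * l%:C ^+ p).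
pose e j p := p`!%:R * (- q) ^+ (j - p) * (stirling2 j p)%:R.
pose K := ((a + m%:R) ^+ k / a ^+ k)%:C.
have BE j : (j <= n)%N ->
    polyBernoulli b j m a q L = K * \sum_(0 <= p < n.+1) (e j p)%:C * t p.
  move=> jn; rewrite /polyBernoulli -/l -/K; congr (_ * _).
  (* Padding with terms where [stirling2 j p = 0] makes the range of [p] independent of [j], so that
     the sums can be exchanged. *)
  have tail : \sum_(j.+1 <= p < n.+1) (e j p)%:C * t p = 0.
    rewrite big_nat big1 // => p /andP[jp _].
    by rewrite /e stirling2E stirling2_rec_small // mulr0 mul0r.
  rewrite [RHS](big_cat_nat (n := j.+1)) //= tail addr0.
  by apply: eq_bigr => p _; rewrite /t /e !rmorphM /=; ring.
transitivity (K * \sum_(1 <= j < n.+1) \sum_(1 <= i < n.+1) \sum_(0 <= p < n.+1)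
    (c i j * e j p)%:C * t p).
  rewrite mulr_sumr; apply: eq_big_nat => j /andP[_ jn].
  rewrite mulr_sumr; apply: eq_bigr => i _; rewrite BE // mulrCA.
  by congr (_ * _); rewrite mulr_sumr; apply: eq_bigr => p _; rewrite mulrA -rmorphM.
congr (_ * _).
under eq_bigr do rewrite exchange_big /=.
rewrite exchange_big /=; apply: eq_big_nat => p /andP[_ pn].
transitivity ((d p)%:C * t p); last by rewrite /t mulrA -rmorphM.
rewrite -dE // rmorph_sum mulr_suml; apply: eq_bigr => j _.
by rewrite rmorph_sum mulr_suml.
Qed.

Theorem theorem11 (R : realType) (b : int) (k : nat) (a q : R) (L : 'I_k -> R)
  (hk : (1 <= k)%N) (ha : a != 0) (hq : q != 0) (hL : forall h : 'I_k, L h != 0)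
  (haj : forall j : nat, a + j%:R != 0)
  (n m : nat) (hn : (1 <= n)%N) :
  (polyCauchy1 b n m a q L =
     \sum_(1 <= j < n.+1) \sum_(1 <= i < n.+1)
       (q ^+ (n - j) * ((-1) ^ (i%:Z - j%:Z) / i`!%:R)
        * stirling1 R n i * stirling1 R i j)%:C
       * polyBernoulli b j m a q L)
  /\
  (polyCauchy2 b n m a q L =
     \sum_(1 <= j < n.+1) \sum_(1 <= i < n.+1)
       ((-1) ^+ j * q ^+ (n - j) * (1 / i`!%:R)
        * stirling1 R n i * stirling1 R i j)%:C
       * polyBernoulli b j m a q L).
Proof.
have nzf j : j`!%:R != 0 :> R by rewrite pnatr_eq0 -lt0n fact_gt0.
have qD j p : (p <= j)%N -> (j <= n)%N -> q ^+ (n - p) = q ^+ (n - j) * q ^+ (j - p).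
  by move=> pj jn; rewrite -exprD addnBA // subnK.
split.
- rewrite (sum_polyBernoulli _ _ _ _ _ _ _ _ _ (fun p => stirling1 R n p * q ^+ (n - p))).
    by congr (_ * _); apply: eq_bigr => p _; rewrite (addrAC a).
  move=> p pn.
  (* The product [q^(n-j) (-1)^(i-j) (-q)^(j-p)] equals [q^(n-p) (-1)^(i-p)], which is free of [j];
     so [w] can serve as the weight in [stirling_sum_collapse]. *)
  pose w i := q ^+ (n - p) * (-1) ^ (i%:Z - p%:Z) * (p`!%:R / i`!%:R).
  have <- : w p = q ^+ (n - p) by rewrite /w subrr expr0z mulfV // !mulr1.
  rewrite [RHS]mulrC -stirling_sum_collapse // /w.
  apply: eq_big_nat => j /andP[_ jn]; apply: eq_bigr => i _.
  (* For [j < p] the exponent [j - p] is truncated to 0, but both sides vanish with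
     [stirling2 j p]. *)
  have [pj|jp] := leqP p j; last by rewrite stirling2E stirling2_rec_small // !mulr0.
  have -> : (-1) ^ (i%:Z - p%:Z) = (-1) ^ (i%:Z - j%:Z) * (-1) ^+ (j - p) :> R.
    by rewrite exprnP -expfzDr ?oppr_eq0 ?oner_eq0 // -subzn // addrA subrK.
  rewrite (qD j p) // (exprNn q); move: ((-1) ^ (_ - _)) => s.
  ring.
- rewrite (sum_polyBernoulli _ _ _ _ _ _ _ _ _
    (fun p => stirling1 R n p * ((-1) ^+ p * q ^+ (n - p)))).
    by congr (_ * _); apply: eq_bigr => p _; rewrite (addrAC a).
  move=> p pn.
  (* Here [(-1)^j (-q)^(j-p) = (-1)^p q^(j-p)], so the sign depends on [p] alone and survives in
     [w p]. *)
  pose w i := (-1) ^+ p * q ^+ (n - p) * (p`!%:R / i`!%:R).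
  have <- : w p = (-1) ^+ p * q ^+ (n - p) by rewrite /w mulfV // mulr1.
  rewrite [RHS]mulrC -stirling_sum_collapse // /w.
  apply: eq_big_nat => j /andP[_ jn]; apply: eq_bigr => i _.
  have [pj|jp] := leqP p j; last by rewrite stirling2E stirling2_rec_small // !mulr0.
  have -> : (-1) ^+ p = (-1) ^+ j * (-1) ^+ (j - p) :> R.
    by rewrite -exprD -{1}(subnK pj) addnAC addnn exprD -mul2n
       exprM sqrrN expr1n expr1n mul1r.
  rewrite (qD j p) // (exprNn q).
  ring.
Qed.
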